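(* Let $r$ be a prime power, let $m\ge 1$ be an integer, and let $q=r^m$. For each integer $s\ge 0$ let $C_{q,r}(s)=\mathcal{H}(q^2,s)\cap \mathbb{F}_r^{q^3}$ be the subfield subcode over $\mathbb{F}_r$ of the $1$-point Hermitian code $\mathcal{H}(q^2,s)\subseteq \mathbb{F}_{q^2}^{q^3}$. Then \[ \dim_{\mathbb{F}_r} C_{q,r}(s)=\begin{cases} 1 & \text{for } 0\le s<\dfrac{q^3}{r},\\[2mm] 2m+1 & \text{for } s=\dfrac{q^3}{r}.\end{cases} \]
   Context: Let $\mathbb{F}_{q^2}$ be the finite field of order $q^2$; since $q=r^m$, it contains $\mathbb{F}_r$ as a subfield, with $[\mathbb{F}_{q^2}:\mathbb{F}_r]=2m$. The Hermitian curve $\mathscr{H}_q$ is the non-singular projective plane curve over $\mathbb{F}_{q^2}$ with homogeneous equation $Y^qZ+YZ^q=X^{q+1}$, that is, with affine equation $y^q+y=x^{q+1}$. It has a unique point at infinity (on the line $Z=0$), namely $P_\infty=(0:1:0)$, and it has exactly $q^3$ affine $\mathbb{F}_{q^2}$-rational points, denoted $P_1,\dots,P_{q^3}$ in some fixed order. For an integer $s\ge 0$, the Riemann-Roch space $\mathscr{L}(sP_\infty)$ is the $\mathbb{F}_{q^2}$-vector space consisting of $0$ and of all non-zero functions $f$ in the function field $\mathbb{F}_{q^2}(\mathscr{H}_q)$ whose principal divisor satisfies $(f)\succcurlyeq -sP_\infty$, that is, which have no pole outside $P_\infty$ and a pole of order at most $s$ at $P_\infty$. The $1$-point Hermitian code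 is the $\mathbb{F}_{q^2}$-linear code \[ \mathcal{H}(q^2,s)=\{(f(P_1),\dots,f(P_{q^3})) : f\in\mathscr{L}(sP_\infty)\}\subseteq \mathbb{F}_{q^2}^{q^3}. \] The subfield subcode over $\mathbb{F}_r$ of an $\mathbb{F}_{q^2}$-linear code $C\subseteq\mathbb{F}_{q^2}^n$ is the $\mathbb{F}_r$-linear code $C\cap\mathbb{F}_r^n$, consisting of all codewords of $C$ whose coordinates all lie in $\mathbb{F}_r$; its dimension is taken over $\mathbb{F}_r$. *)

(* Defs.v *)
From HB Require Import structures.
From mathcomp Require Import all_boot all_order all_algebra all_field.

Set Implicit Arguments.
Unset Strict Implicit.
Unset Printing Implicit Defensive.

Import Order.TTheory GRing.Theory Num.Theory.
Local Open Scope ring_scope.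

(* Bivariate polynomials are elements of {poly {poly F}}: the outer variable  *)
(* is Y and the coefficients are polynomials in X.                            *)
Definition eval2 (R : nzRingType) (a b : R) (g : {poly {poly R}}) : R :=
  g.[b%:P].[a].

Definition hermitian_poly (R : nzRingType) (q : nat) : {poly {poly R}} :=
  'X^q + 'X - ('X^(q.+1))%:P.

Definition on_curve (F : nzRingType) (q : nat) (ab : F * F) : Prop :=
  eval2 ab.1 ab.2 (hermitian_poly F q) = 0.

Section FunctionField.

Variables (F L : fieldType) (iota : {rmorphism F -> L}) (x y : L).

Definition fun_of_poly (g : {poly {poly F}}) : L :=
  eval2 x y (map_poly (map_poly iota) g).

(* L is the fraction field of the coordinate ring F[X,Y]/(Y^q + Y - X^(q+1)), *)
(* x and y being the classes of X and Y: the kernel of g |-> g(x,y) is the    *)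
(* ideal of the curve, and every element of L is a quotient of values.        *)
Definition hermitian_function_field (q : nat) : Prop :=
  (forall g : {poly {poly F}},
     fun_of_poly g = 0 <-> exists k, g = k * hermitian_poly F q) /\
  (forall f : L, exists g h : {poly {poly F}},
     fun_of_poly h != 0 /\ f = fun_of_poly g / fun_of_poly h).

(* A place of L/F, given by its normalized discrete valuation.  The value     *)
(* at 0, which should be +oo, is left unconstrained and is never used.        *)
Record place := Place {
  ord_at :> L -> int;
  ord_atM : forall f g, f != 0 -> g != 0 ->
    ord_at (f * g) = ord_at f + ord_at g;
  ord_atD : forall f g, f != 0 -> g != 0 -> f + g != 0 ->
    Num.min (ord_at f) (ord_at g) <= ord_at (f + g);
  ord_atC : forall c : F, c != 0 -> ord_at (iota c) = 0;
  ord_at_normalized : exists2 t, t != 0 & ord_at t = 1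
}.

(* In the chart Y = 1 the affine coordinates are X/Y = x/y and Z/Y = 1/y, and *)
(* P_oo = (0:1:0) is the origin: P is the place of P_oo when both vanish.     *)
Definition is_Pinf (P : place) : bool := (0 < P (x / y)) && (0 < P y^-1).

Definition divisor := place -> int.

Definition principal_divisor (f : L) : divisor := fun P => P f.

Definition div_ge (D E : divisor) : Prop := forall P, E P <= D P.

Definition sPinf (s : nat) : divisor := fun P => if is_Pinf P then s%:Z else 0.

Definition riemann_roch (D : divisor) (f : L) : Prop :=
  f = 0 \/ f != 0 /\ div_ge (principal_divisor f) (fun P => - D P).

Definition value_at (f : L) (ab : F * F) (c : F) : Prop :=
  exists g h : {poly {poly F}},
    [/\ eval2 ab.1 ab.2 h != 0,
        f = fun_of_poly g / fun_of_poly h &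
        c = eval2 ab.1 ab.2 g / eval2 ab.1 ab.2 h].

Definition hermitian_code (n : nat) (P : 'I_n -> F * F) (s : nat)
    (w : 'rV[F]_n) : Prop :=
  exists2 f : L, riemann_roch (sPinf s) f &
    forall i, value_at f (P i) (w ord0 i).

End FunctionField.

(* F_r^n is identified with its image in F^n under the embedding.             *)
Definition subfield_subcode (Fr F : fieldType) (emb : {rmorphism Fr -> F})
    (n : nat) (C : 'rV[F]_n -> Prop) (c : 'rV[Fr]_n) : Prop :=
  C (map_mx emb c).

Definition linear_code_of_dim (K : fieldType) (n : nat) (C : 'rV[K]_n -> Prop)
    (d : nat) : Prop :=
  exists2 V : {vspace 'rV[K]_n}, (forall c, c \in V <-> C c) & (\dim V = d)%N.

(* Main.v *)
Require Import Defs.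
From Stdlib Require Import ClassicalEpsilon.
From HB Require Import structures.
From mathcomp Require Import all_boot all_order all_algebra all_field.
From mathcomp Require Import zify ring.

Set Implicit Arguments.
Unset Strict Implicit.
Unset Printing Implicit Defensive.

Import Order.TTheory GRing.Theory Num.Theory.
Local Open Scope ring_scope.

(** Let [f] be a function in [L(s P_oo)] whose values at the [q^3] affine
rational points lie in [F_r].  Then [f^r - f] vanishes at all these points and
has a pole of order at most [r s] at [P_oo] and no other pole.  Since
[x^(q^2) - x] vanishes exactly at the rational points, with simple zeros, and
has a pole of order [q^3] at [P_oo], the function [f^r - f] is zero when
[r s < q^3], and is [a (x^(q^2) - x)] for some [a] in [F_(q^2)] when
[r s = q^3].  In the first case [f] is a constant of [F_r].  In the second one,
[q^2 = r^(2m)] shows that the trace [T(a x) = sum_(i < 2m) (a x)^(r^i)]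
satisfies the same equation [T^r - T = a (x^(q^2) - x)], so that
[f = T(a x) + k] with [k] in [F_r].  Conversely each such [f] has values in
[F_r] and a pole of order at most [q r^(2m-1) = q^3/r].  The pairs [(a, k)] form
a set of [r^(2m+1)] elements on which the evaluation is injective, because the
trace is a nonzero form on [F_(q^2)] and each element of [F_(q^2)] is the
abscissa of a rational point.

The divisor of [x^(q^2) - x] is replaced by a count of monomials: a function
without poles outside [P_oo] is represented by a polynomial [g(x, y)] of degree
less than [q] in [y]; its monomials [x^i y^l] have the distinct pole orders
[i q + l (q + 1)] at [P_oo], so a bound on the pole order of [g] bounds each
exponent ([ord_reduced]); and a polynomial of degree less than [q] in [y] and
less than [q^2] in [x] that vanishes at [q^3] points is zero
([reduced_vanishing]).

The Riemann-Roch space is defined by conditions at all places, so places must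
be produced in order to use these conditions.
- At a point [(a, b)] of the curve over an extension [K] of [F], the polynomial
  [Y^q + Y - X^(q+1)] has derivative 1 in [Y]; hence [X = a + t] determines
  [Y] as a power series in [t], and the order in [t] is a valuation
  ([place_at_point]).  Polynomial truncations of [Y] suffice.
- The functions [x/y] and [1/y] satisfy the equation of the curve again, so the
  place at infinity is the place at their origin ([Pinf_exists]).
- A function regular at the affine places is a polynomial in [x] and [y]: after
  clearing denominators it is [g(x, y) / N(x)], and at a root [a] of [N] the
  [q] points of the fibre cannot all be zeros of [g(a, Y)], of degree less than
  [q], unless [N] and the coefficients of [g] have a common factor
  ([regular_is_polynomial]). *)

(** * Evaluation of bivariate polynomials *)

Section Evaluation.

Variables (F : fieldType) (R : comNzRingType) (j : {rmorphism F -> R}).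
Variables (a b : R).

Definition ev (g : {poly {poly F}}) : R :=
  eval2 a b (map_poly (map_poly j) g).

HB.instance Definition _ := GRing.RMorphism.copy ev
  (horner_eval a \o horner_eval b%:P \o map_poly (map_poly j)).

Lemma ev_coef (p : {poly F}) : ev p%:P = (map_poly j p).[a].
Proof. by rewrite /ev /eval2 map_polyC hornerC. Qed.

Lemma ev_const (c : F) : ev c%:P%:P = j c.
Proof. by rewrite ev_coef map_polyC hornerC. Qed.

Lemma ev_X : ev 'X%:P = a.
Proof. by rewrite ev_coef map_polyX hornerX. Qed.

Lemma ev_Y : ev 'X = b.
Proof. by rewrite /ev /eval2 map_polyX hornerX hornerC. Qed.

Lemma ev_hermitian q : ev (hermitian_poly F q) = b ^+ q + b - a ^+ q.+1.
Proof. by rewrite rmorphB rmorphD !rmorphXn /= ev_X ev_Y. Qed.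

(** The bounds [n] and [m] need not be the exact sizes, so that the
coefficients can be indexed by a rectangle that suits the use. *)
Lemma ev_box n m (g : {poly {poly F}}) : (size g <= n)%N -> (forall k, (size (g`_k)%R <= m)%N) ->
  ev g = \sum_(k < n) \sum_(i < m) j g`_k`_i * a ^+ i * b ^+ k.
Proof.
move=> gn gm; rewrite /ev /eval2 [_.[b%:P]](@horner_coef_wide _ n); last first.
  exact: leq_trans (size_poly _ _) gn.
rewrite horner_sum; apply: eq_bigr => k _.
rewrite hornerM horner_exp hornerC -mulr_suml coef_map_id0 ?rmorph0 //.
rewrite (@horner_coef_wide _ m); last exact: leq_trans (size_poly _ _) (gm k).
by congr (_ * _); apply: eq_bigr => i _; rewrite coef_map.
Qed.

End Evaluation.

Lemma coef_size_bound (R : nzRingType) (g : {poly {poly R}}) :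
  exists m, forall k, (size (g`_k)%R <= m)%N.
Proof.
exists (\max_(k < size g) size (g`_k)%R)%N => k.
have [kg|kg] := ltnP k (size g); last by rewrite nth_default // size_poly0.
exact: (leq_bigmax (F := fun k : 'I_(size g) => size (g`_k)%R) (Ordinal kg)).
Qed.

Lemma ev_rmorph (F : fieldType) (R S : comNzRingType) (j : {rmorphism F -> R})
    (k : {rmorphism F -> S}) (f : {rmorphism R -> S}) a b g :
  (forall c, f (j c) = k c) -> f (ev j a b g) = ev k (f a) (f b) g.
Proof.
move=> fj; have [m gm] := coef_size_bound g.
rewrite !(ev_box _ _ _ (leqnn _) gm) rmorph_sum; apply: eq_bigr => u _.
rewrite rmorph_sum; apply: eq_bigr => v _.
by rewrite !rmorphM !rmorphXn fj.
Qed.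

Lemma ev_congr (F : fieldType) (R : comNzRingType) (j : {rmorphism F -> R})
    a b b' g : exists c, ev j a b g - ev j a b' g = (b - b') * c.
Proof.
elim/poly_ind: g => [|g p [c IH]]; first by exists 0; rewrite !rmorph0 mulr0 subr0.
exists (c * b + ev j a b' g).
rewrite !rmorphD !rmorphM /= !ev_Y !ev_coef opprD addrACA subrr addr0.
rewrite mulrDr mulrA -IH mulrBl; ring.
Qed.

Section FunctionFieldBasics.

Variables (F L : fieldType) (iota : {rmorphism F -> L}) (x y : L) (q : nat).
Hypothesis ffL : hermitian_function_field iota x y q.
Hypothesis q_gt1 : (1 < q)%N.
Implicit Types g h : {poly {poly F}}.
Notation H := (hermitian_poly F q).
Notation val := (ev iota x y).

Lemma size_hermitian : size H = q.+1.
Proof.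
rewrite /hermitian_poly -addrA size_polyDl size_polyXn //.
rewrite (leq_ltn_trans (size_polyD _ _)) // size_polyX size_polyN gtn_max.
by rewrite ltnS q_gt1 (leq_ltn_trans (size_polyC_leq1 _)) // ltnS ltnW.
Qed.

Lemma monic_hermitian : H \is monic.
Proof.
rewrite monicE /hermitian_poly -addrA lead_coefDl ?lead_coefXn //.
rewrite size_polyXn (leq_ltn_trans (size_polyD _ _)) // size_polyX size_polyN gtn_max.
by rewrite ltnS q_gt1 (leq_ltn_trans (size_polyC_leq1 _)) // ltnS ltnW.
Qed.

Lemma ev_eq0 g : val g = 0 <-> exists k, g = k * H.
Proof. exact: ffL.1. Qed.

Lemma ev_curve_congr (R : comNzRingType) (j : {rmorphism F -> R}) a b g h :
  val g = val h -> b ^+ q + b = a ^+ q.+1 -> ev j a b g = ev j a b h.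
Proof.
move=> gh ab; have [k ghk] : exists k, g - h = k * H.
  by apply/ev_eq0; rewrite raddfB /= gh subrr.
have -> : g = k * H + h by rewrite -ghk subrK.
by rewrite rmorphD rmorphM /= ev_hermitian ab subrr mulr0 add0r.
Qed.

Lemma ev_curve : y ^+ q + y = x ^+ q.+1.
Proof.
by apply/subr0_eq; rewrite -(ev_hermitian iota); apply/ev_eq0; exists 1; rewrite mul1r.
Qed.

(** The relation that [x] and [y] satisfy is monic of degree [q] in [y], so
no nonzero multiple of it has degree less than [q] in [y]. *)
Lemma ev_reduced_neq0 g : (size g <= q)%N -> g != 0 -> val g != 0.
Proof.
move=> sg g0; apply/eqP => /ev_eq0[k gE]; move: sg g0; rewrite gE.
have [-> | k0 ] := eqVneq k 0; first by rewrite mul0r eqxx.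
rewrite size_Mmonic ?monic_hermitian // size_hermitian addnS /= leqNgt.
by rewrite -[X in (X < _)%N]add0n ltn_add2r size_poly_gt0 k0.
Qed.

Lemma ev_coef_neq0 (p : {poly F}) : p != 0 -> val p%:P != 0.
Proof.
move=> p0; apply: ev_reduced_neq0; last by rewrite polyC_eq0.
by rewrite (leq_trans (size_polyC_leq1 _)) // ltnW.
Qed.

Lemma x_neq0 : x != 0.
Proof. by rewrite -(ev_X iota x y) ev_coef_neq0 // polyX_eq0. Qed.

Lemma y_neq0 : y != 0.
Proof. by rewrite -(ev_Y iota x y) ev_reduced_neq0 ?size_polyX ?polyX_eq0. Qed.

Lemma reduction g : exists2 g' : {poly {poly F}}, (size g' <= q)%N & val g' = val g.
Proof.
exists (Pdiv.Ring.rmodp g H).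
  by rewrite -ltnS -size_hermitian Pdiv.Ring.ltn_rmodpN0 ?monic_neq0 ?monic_hermitian.
rewrite [in RHS](Pdiv.RingMonic.rdivp_eq monic_hermitian g) rmorphD.
by rewrite [X in X + _](_ : _ = 0) ?add0r //; apply/ev_eq0; exists (Pdiv.Ring.rdivp g H).
Qed.

(** The resultant of [g] and the equation of the curve with respect to [y]
eliminates [y].  If it were zero, then [g] and the equation would have a common
factor [d] of positive degree.  Since [L] is a field, [d] or its cofactor in the
equation would vanish at [(x, y)]: the former contradicts [g(x, y) != 0], and
the latter has too small a degree. *)
Lemma elimination g : val g != 0 ->
  exists u N, N != 0 /\ val (u * g) = val N%:P.
Proof.
move=> g0; have [sg|sg] := leqP (size g) 1.
  exists 1, g`_0; move: g0; rewrite (size1_polyC sg) mul1r coefC eqxx => g0; split=> //.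
  by apply: contra_neq g0 => ->; rewrite rmorph0.
have sH : (1 < size H)%N by rewrite size_hermitian ltnS ltnW.
have [[v u] /= _ uvE] := resultant_in_ideal sH sg.
exists u, (resultant H g); split; last first.
  rewrite uvE rmorphD [X in X + _](_ : _ = 0) ?add0r //.
  by apply/ev_eq0; exists v.
rewrite resultant_eq0 -leqNgt.
have /Pdiv.Idomain.dvdpP[[c e] /= c0 cH] := dvdp_gcdl H g.
have /Pdiv.Idomain.dvdpP[[c' e'] /= c'0 c'g] := dvdp_gcdr H g.
set d := gcdp H g in cH c'g *.
have : val e * val d == 0.
  by rewrite -rmorphM -cH; apply/eqP/ev_eq0; exists c%:P; rewrite mul_polyC.
rewrite mulf_eq0 => /orP[/eqP/ev_eq0[k ek]|/eqP d0]; last first.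
  have : val (c' *: g) == 0 by rewrite c'g rmorphM /= d0 mulr0.
  by rewrite -mul_polyC rmorphM mulf_eq0 (negPf g0) (negPf (ev_coef_neq0 c'0)).
have H0 : H != 0 by rewrite monic_neq0 ?monic_hermitian.
have /eqP : c%:P = k * d.
  by apply: (mulIf H0); rewrite mul_polyC cH ek -!mulrA [d * _]mulrC.
have c1 : size (c%:P : {poly {poly F}}) = 1 by rewrite size_polyC c0.
move=> /eqP cE; have kd0 : k * d != 0 by rewrite -cE polyC_eq0.
move: (kd0); rewrite mulf_eq0 negb_or => /andP[k0 d0].
have := c1; rewrite cE size_mul //.
move: k0 d0; rewrite -!size_poly_gt0; case: (size k) => // n; case: (size d) => // [[|n']] //.
by rewrite !addSn !addnS.
Qed.

End FunctionFieldBasics.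
(** * Places from valuations *)

Section PlaceOfRelation.

Variables (F L : fieldType) (iota : {rmorphism F -> L}).
Variable V : L -> int -> Prop.
Hypothesis V_total : forall f, f != 0 -> exists z, V f z.
Hypothesis V_uniq : forall f z z', f != 0 -> V f z -> V f z' -> z = z'.
Hypothesis V_mul : forall f g z z', f != 0 -> g != 0 ->
  V f z -> V g z' -> V (f * g) (z + z').
Hypothesis V_add : forall f g z z' z'', f != 0 -> g != 0 -> f + g != 0 ->
  V f z -> V g z' -> V (f + g) z'' -> Num.min z z' <= z''.
Hypothesis V_const : forall c : F, c != 0 -> V (iota c) 0.
Hypothesis V_nontrivial : exists t z, [/\ t != 0, V t z & z != 0].

(** Valuations are found below as relations with values in a nontrivial
subgroup of the integers; choice turns them into functions, and division by the
positive generator of the value group normalizes them, which spares the search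
for a uniformizer inside [L]. *)
Lemma place_of_relation : exists Q : place iota, exists2 d : int,
  0 < d & forall f, f != 0 -> V f (Q f * d).
Proof.
have V_fun f : exists z, f != 0 -> V f z.
  by have [->|/V_total[z Vz]] := eqVneq f 0; [exists 0|exists z].
pose v f := proj1_sig (constructive_indefinite_description _ (V_fun f)).
have vP f : f != 0 -> V f (v f).
  exact: (proj2_sig (constructive_indefinite_description _ (V_fun f))).
have vM f g : f != 0 -> g != 0 -> v (f * g) = v f + v g.
  move=> f0 g0; have fg0 : f * g != 0 by rewrite mulf_neq0.
  by apply: V_uniq (vP _ fg0) _ => //; apply: V_mul => //; apply: vP.
have vD f g : f != 0 -> g != 0 -> f + g != 0 -> Num.min (v f) (v g) <= v (f + g).
  by move=> f0 g0 fg0; apply: (@V_add f g) => //; apply: vP.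
have vC (c : F) : c != 0 -> v (iota c) = 0.
  move=> c0; have ic0 : iota c != 0 by rewrite fmorph_eq0.
  by apply: V_uniq (vP _ ic0) _ => //; apply: V_const.
have v1 : v 1 = 0 by rewrite -(rmorph1 iota) vC ?oner_eq0.
have vV f : f != 0 -> v f^-1 = - v f.
  move=> f0; have := vM _ _ f0 (invr_neq0 f0); rewrite divff // v1 => /esym/eqP.
  by rewrite addrC addr_eq0 => /eqP.
have vX f n : f != 0 -> v (f ^+ n) = v f * n%:Z.
  move=> f0; elim: n => [|n IH]; first by rewrite expr0 v1 mulr0.
  by rewrite exprS vM ?expf_neq0 // IH -[n.+1]add1n PoszD mulrDr mulr1.
have vZ f (n : int) : f != 0 -> v (f ^ n) = v f * n.
  move=> f0; case: n => n; first exact: vX.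
  by rewrite NegzE -exprz_inv /exprz vX ?invr_eq0 // vV // mulrN mulNr.
(* The image of v is a nonzero subgroup of the integers, so the least positive *)
(* value d of v generates it.                                                 *)
have [d [d0 [t [t0 vt]] dmin]] : exists d : nat, [/\ (0 < d)%N,
    exists t, t != 0 /\ v t = d &
    forall e : nat, (0 < e < d)%N -> forall f, f != 0 -> v f <> e].
  have [e [e0 [t [t0 vt]]]] : exists e : nat, (0 < e)%N /\ exists t, t != 0 /\ v t = e.
    have [t [z [t0 Vt z0]]] := V_nontrivial.
    have vt : v t = z by apply: V_uniq (vP _ t0) Vt.
    case: z z0 vt {Vt} => n z0 vt.
      by exists n; rewrite lt0n z0; split => //; exists t.
    exists n.+1; split=> //; exists t^-1.
    by rewrite invr_eq0 vV // vt NegzE opprK.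
  elim/ltn_ind: e t e0 t0 vt => e IH t e0 t0 vt.
  have [[e' [/andP[e'0 e'e] [f [f0 vf]]]]|no] := classic (exists e' : nat,
      (0 < e' < e)%N /\ exists f, f != 0 /\ v f = e').
    exact: IH e' e'e f e'0 f0 vf.
  exists e; split=> //; first by exists t.
  by move=> e' e'e f f0 vf; apply: no; exists e'; split=> //; exists f.
have dvd f : f != 0 -> v f = (v f %/ d)%Z * d.
  move=> f0; rewrite [LHS](divz_eq _ d).
  have dz : d%:Z != 0 by rewrite eqz_nat -lt0n.
  suff -> : (v f %% d)%Z = 0 by rewrite addr0.
  pose f' := f * t ^ (- (v f %/ d)%Z).
  have f'0 : f' != 0 by rewrite mulf_neq0 // expfz_neq0.
  have vf' : v f' = (v f %% d)%Z.
    by rewrite vM ?expfz_neq0 // vZ // vt {1}(divz_eq (v f) d) mulrN mulrC addrC addKr.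
  have := modz_ge0 (v f) dz; have := ltz_mod (v f) dz.
  rewrite -vf'; case E: (v f') => [n|//] /=; rewrite ltz_nat => nd _.
  have [->//|n0] := posnP n.
  by have := dmin n; rewrite n0 nd => /(_ isT f' f'0).
have dpos : 0 < d%:Z by rewrite ltz_nat.
pose w f := (v f %/ d)%Z.
have wM f g : f != 0 -> g != 0 -> w (f * g) = w f + w g.
  move=> f0 g0; apply: (mulIf (lt0r_neq0 dpos)).
  by rewrite mulrDl -!dvd ?mulf_neq0 // vM.
have wD f g : f != 0 -> g != 0 -> f + g != 0 -> Num.min (w f) (w g) <= w (f + g).
  move=> f0 g0 fg0; rewrite -(ler_pM2r dpos) minr_pMl; last exact: ltW.
  by rewrite -!dvd // vD.
have wC (c : F) : c != 0 -> w (iota c) = 0 by move=> c0; rewrite /w vC // div0z.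
have wN : exists2 s, s != 0 & w s = 1.
  by exists t => //; rewrite /w vt divzz eqz_nat -lt0n d0.
exists (Place wM wD wC wN), d%:Z => // f f0 /=.
by rewrite -dvd //; apply: vP.
Qed.

End PlaceOfRelation.

Lemma pchar_nat_rmorph (R S : nzRingType) (f : {rmorphism R -> S}) q :
  [pchar R].-nat q -> [pchar S].-nat q.
Proof. by apply: sub_in_pnat => p _; apply: rmorph_pchar. Qed.

Lemma exprBn_pchar (R : comNzRingType) (a b : R) q :
  [pchar R].-nat q -> (a - b) ^+ q = a ^+ q - b ^+ q.
Proof. by move=> qp; rewrite exprDn_pchar // exprNn_pchar. Qed.

Lemma root0_factor (R : nzRingType) (p : {poly R}) :
  p.[0] = 0 -> exists c, p = 'X * c.
Proof.
move=> p0; have /factor_theorem[c ->] : root p 0 by apply/eqP.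
by exists c; rewrite subr0 commr_polyX.
Qed.

Lemma X_order_exists (K : fieldType) (p : {poly K}) :
  p != 0 -> exists n u, u.[0] != 0 /\ p = 'X^n * u.
Proof.
have [n [u ur E]] := multiplicity_XsubC p 0 => p0.
by exists n, u; rewrite p0 in ur; split=> //; rewrite E subr0 mulrC.
Qed.

Lemma horner0_XnM (K : fieldType) (u : {poly K}) n :
  ('X^n * u).[0] = if n == 0%N then u.[0] else 0.
Proof. by rewrite hornerM hornerXn expr0n; case: eqP; rewrite ?mul1r ?mul0r. Qed.

Lemma X_order_le (K : fieldType) (u w : {poly K}) n m :
  u.[0] != 0 -> 'X^n * u = 'X^m * w -> (m <= n)%N.
Proof.
move=> u0 E; rewrite leqNgt; apply/negP => nm.
move: E; rewrite -(subnK (ltnW nm)) addnC exprD -mulrA => /(mulfI _)E.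
have {E}/(congr1 (horner^~ 0)) : u = 'X^(m - n) * w.
  by apply: E; rewrite monic_neq0 ?monicXn.
by rewrite horner0_XnM subn_eq0 leqNgt nm /= => uE; rewrite uE eqxx in u0.
Qed.

(** * The place at an affine point *)

Section PlaceAtPoint.

Variables (F L : fieldType) (iota : {rmorphism F -> L}) (x y : L) (q : nat).
Hypothesis ffL : hermitian_function_field iota x y q.
Hypothesis q_gt1 : (1 < q)%N.
Hypothesis q_pchar : [pchar F].-nat q.
Notation val := (ev iota x y).

Variables (K : fieldType) (j : {rmorphism F -> K}) (a b : K).
Hypothesis ab_curve : b ^+ q + b = a ^+ q.+1.
Implicit Types g h : {poly {poly F}}.

(** On the branch [X = a + t] through [(a, b)], the equation
[Y = X^(q+1) - Y^q] has a unique power series solution with constant term [b],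
to which the iteration converges in the [t]-adic sense. *)
Definition branch (k : nat) : {poly K} :=
  iter k (fun Y => (a%:P + 'X) ^+ q.+1 - Y ^+ q) b%:P.

Lemma branch0 k : (branch k).[0] = b.
Proof.
elim: k => [|k IH] /=; first by rewrite hornerC.
by rewrite hornerD hornerN !horner_exp IH hornerD hornerC hornerX addr0 -ab_curve addrAC subrr add0r.
Qed.

Let q_pcharK : [pchar {poly K}].-nat q.
Proof. exact: (pchar_nat_rmorph (@polyC K) (pchar_nat_rmorph j q_pchar)). Qed.

(** The [q]-th power is additive, so it raises the [t]-adic order of the
difference of two consecutive approximations. *)
Lemma branch_step k : exists c, branch k.+1 - branch k = 'X^(k.+1) * c.
Proof.
elim: k => [|k [c IH]].
  by apply: root0_factor; rewrite hornerD hornerN !branch0 subrr.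
have -> : branch k.+2 - branch k.+1 = - (branch k.+1 - branch k) ^+ q.
  by rewrite exprBn_pchar //=; ring.
rewrite IH exprMn -exprM; exists (- ('X^(k.+1 * q - k.+2) * c ^+ q)).
rewrite mulrN mulrA -exprD subnKC //.
by rewrite (leq_trans _ (leq_mul (leqnn k.+1) q_gt1)) // muln2 -addnn !addnS ltnS ltnS leq_addr.
Qed.

Lemma branch_conv k k' : (k <= k')%N -> exists c, branch k' - branch k = 'X^(k.+1) * c.
Proof.
move=> /subnK <-; elim: (k' - k)%N => [|n [c IH]]; first by exists 0; rewrite subrr mulr0.
have [c' E] := branch_step (n + k).
exists (c + 'X^n * c'); rewrite mulrDr -IH mulrA -exprD !addSn [(k + n)%N]addnC -E.
by rewrite [RHS]addrC addrA subrK.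
Qed.

(** The [k]-th expansion of [g(x, y)] is correct modulo [t^(k+1)]: see
[expansion_conv] and [expansion_hermitian]. *)
Definition expansion (k : nat) : {poly {poly F}} -> {poly K} :=
  ev (polyC \o j) (a%:P + 'X) (branch k).

HB.instance Definition _ k := GRing.RMorphism.copy (expansion k)
  (ev (polyC \o j) (a%:P + 'X) (branch k)).

Lemma expansion_conv g k k' : (k <= k')%N ->
  exists c, expansion k' g - expansion k g = 'X^(k.+1) * c.
Proof.
move=> /branch_conv[c E].
have [c' E'] := ev_congr (polyC \o j) (a%:P + 'X) (branch k') (branch k) g.
by exists (c * c'); rewrite mulrA -E -E'.
Qed.

Lemma expansion_at0 g k : (expansion k g).[0] = ev j a b g.
Proof.
rewrite -[LHS]/(horner_eval 0 _) (@ev_rmorph _ _ _ _ j) => [|c]; last first.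
  exact: hornerC.
by rewrite /= /horner_eval branch0 hornerD hornerC hornerX addr0.
Qed.

Lemma expansion_hermitian k : exists c, expansion k (hermitian_poly F q) = 'X^(k.+1) * c.
Proof.
have [c E] := branch_step k; exists (- c).
by rewrite /expansion ev_hermitian mulrN -E /=; ring.
Qed.

Lemma expansion_coef (p : {poly F}) k :
  expansion k p%:P = map_poly j p \Po (a%:P + 'X).
Proof. by rewrite /expansion ev_coef /comp_poly map_poly_comp. Qed.

(** The [t]-adic order of [g(x, y)] is read on every sufficiently accurate
expansion, where it is constant. *)
Definition has_order g (n : nat) : Prop :=
  exists k0, forall k, (k0 <= k)%N -> exists u, u.[0] != 0 /\ expansion k g = 'X^n * u.

Lemma has_orderU g n m : has_order g n -> has_order g m -> n = m.
Proof.
move=> [k0 gn] [k1 gm].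
have [u [u0 E]] := gn _ (leq_maxl k0 k1); have [w [w0 E']] := gm _ (leq_maxr k0 k1).
by rewrite E in E'; apply/eqP; rewrite eqn_leq (X_order_le w0 (esym E')) (X_order_le u0 E').
Qed.

Lemma has_orderM g h n m : has_order g n -> has_order h m -> has_order (g * h) (n + m).
Proof.
move=> [k0 gn] [k1 hm]; exists (maxn k0 k1) => k; rewrite geq_max => /andP[/gn[u [u0 E]] /hm[w [w0 E']]].
exists (u * w); rewrite hornerM mulf_neq0 //; split=> //.
by rewrite rmorphM /= E E' exprD; ring.
Qed.

Lemma has_orderD g h n m l : has_order g n -> has_order h m -> has_order (g + h) l ->
  (minn n m <= l)%N.
Proof.
move=> [k0 gn] [k1 hm] [k2 ghl]; pose k := maxn k0 (maxn k1 k2).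
have [u [_ E]] := gn k (leq_maxl _ _).
have [|w [_ E']] := hm k; first by rewrite !leq_max leqnn orbT.
have [|z [z0]] := ghl k; first by rewrite !leq_max leqnn !orbT.
rewrite rmorphD /= E E' => E''.
apply: (X_order_le (w := 'X^(n - minn n m) * u + 'X^(m - minn n m) * w) z0).
by rewrite -E'' mulrDr !mulrA -!exprD !subnKC ?geq_minl ?geq_minr.
Qed.

Lemma has_order_congr g h n : val g = val h -> has_order g n -> has_order h n.
Proof.
move=> gh [k0 gn]; have [k E] : exists k, g - h = k * hermitian_poly F q.
  by apply/(ev_eq0 ffL); rewrite raddfB /= gh subrr.
exists (maxn k0 n) => i; rewrite geq_max => /andP[/gn[u [u0 gE]] ni].
have [c Hc] := expansion_hermitian i.
have {}E : h = g - k * hermitian_poly F q by rewrite -E; ring.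
exists (u - 'X^(i.+1 - n) * (expansion i k * c)); split.
  by rewrite hornerD hornerN horner0_XnM subn_eq0 leqNgt ltnS ni /= subr0.
rewrite E rmorphB rmorphM /= gE Hc mulrBr (mulrA 'X^n) -exprD subnKC ?leqW //.
by ring.
Qed.

Lemma has_order_const (c : F) : c != 0 -> has_order c%:P%:P 0.
Proof.
move=> c0; exists 0%N => k _; exists (j c)%:P.
by rewrite hornerC fmorph_eq0 c0 mul1r /expansion ev_const.
Qed.

(** Some multiple of [g(x, y)] is a nonzero polynomial in [x], and the
expansion of the latter is the same at all levels; its order bounds that of [g],
and beyond this bound all expansions of [g] agree up to their leading term. *)
Lemma has_order_exists g : val g != 0 -> exists n, has_order g n.
Proof.
move=> /(elimination ffL q_gt1)[u [N [N0 uE]]].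
have [n0 [k0 Nn]] : exists n, has_order N%:P n.
  have /X_order_exists[n [w [w0 E]]] : map_poly j N \Po (a%:P + 'X) != 0.
    by rewrite addrC comp_poly2_eq0 ?size_XaddC // map_poly_eq0.
  by exists n, 0%N => k _; exists w; rewrite expansion_coef.
have {Nn}[k1 ugn] : has_order (u * g) n0.
  by apply: has_order_congr (esym uE) _; exists k0.
pose k := maxn k1 n0; have [w [w0]] := ugn k (leq_maxl _ _).
rewrite rmorphM /= => E.
have : expansion k u * expansion k g != 0.
  by rewrite E; apply: contraNneq w0 => /eqP; rewrite mulf_eq0 -size_poly_eq0 size_polyXn => /eqP ->; rewrite horner0.
rewrite mulf_eq0 negb_or => /andP[/X_order_exists[n1 [w1 [w10 E1]]] /X_order_exists[n [w2 [w20 E2]]]].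
have nn0 : (n <= n0)%N.
  by apply: (X_order_le (w := w1 * w2 * 'X^n1) w0); rewrite -E E1 E2; ring.
exists n, k => k' /(expansion_conv g)[c /eqP]; rewrite subr_eq => /eqP ->.
have nk : (n <= k)%N by rewrite leq_max nn0 orbT.
exists (w2 + 'X^(k.+1 - n) * c); rewrite hornerD horner0_XnM subn_eq0 leqNgt ltnS nk /= addr0.
by split=> //; rewrite E2 mulrDr mulrA -exprD subnKC ?leqW // addrC.
Qed.

Lemma has_order_at0 g n : has_order g n -> (n != 0%N) = (ev j a b g == 0).
Proof.
move=> [k gn]; have [u [u0 E]] := gn k (leqnn _).
by rewrite -(expansion_at0 g k) E horner0_XnM; case: eqP; rewrite ?eqxx // (negPf u0).
Qed.

(** A relation rather than a function, since a quotient has many numerators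
and denominators; [has_ordU] shows that their choice does not matter. *)
Definition has_ord (f : L) (z : int) : Prop :=
  exists g h n m, [/\ val g != 0, val h != 0, f = val g / val h,
    has_order g n /\ has_order h m & z = n%:Z - m%:Z].

Lemma has_ordU f z z' : has_ord f z -> has_ord f z' -> z = z'.
Proof.
move=> [g [h [n [m [g0 h0 -> [gn hm] ->]]]]] [g' [h' [n' [m' [g'0 h'0 /eqP E [gn' hm'] ->]]]]].
move: E; rewrite eqr_div // -!rmorphM => /eqP E.
have := has_orderU (has_order_congr E (has_orderM gn hm')) (has_orderM gn' hm).
by move=> {}E; apply/eqP; rewrite subr_eq addrAC eq_sym subr_eq -!PoszD E.
Qed.

(** The polynomial [N] says that [a] is algebraic over [F]: otherwise the
order would be trivial on [L]. *)
Lemma place_at_point (N : {poly F}) : N != 0 -> root (map_poly j N) a ->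
  exists Q : place iota, forall g, val g != 0 ->
    0 <= Q (val g) /\ (0 < Q (val g)) = (ev j a b g == 0).
Proof.
move=> N0 Na; have val1 : val 1 != 0 by rewrite rmorph1 oner_neq0.
have one0 : has_order 1 0.
  by rewrite -[1]/(1%:P%:P); apply: has_order_const; rewrite oner_eq0.
have has_ord_poly g n : val g != 0 -> has_order g n -> has_ord (val g) n.
  by move=> g0 gn; exists g, 1, n, 0%N; rewrite val1 rmorph1 divr1 subr0.
have [Q [d d0 QE]] : exists Q : place iota, exists2 d : int,
    0 < d & forall f, f != 0 -> has_ord f (Q f * d).
  apply: place_of_relation.
  - move=> f f0; have [g [h [h0 fE]]] := ffL.2 f.
    rewrite -[fun_of_poly _ _ _ g]/(val g) -[fun_of_poly _ _ _ h]/(val h) in h0 fE.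
    have g0 : val g != 0 by apply: contra_neq f0 => g0; rewrite fE g0 mul0r.
    have [[n gn] [m hm]] := (has_order_exists g0, has_order_exists h0).
    by exists (n%:Z - m%:Z), g, h, n, m.
  - by move=> f z z' _; apply: has_ordU.
  - move=> f f' z z' _ _ [g [h [n [m [g0 h0 -> [gn hm] ->]]]]].
    move=> [g' [h' [n' [m' [g'0 h'0 -> [gn' hm'] ->]]]]].
    exists (g * g'), (h * h'), (n + n')%N, (m + m')%N; rewrite !rmorphM !mulf_neq0 //=; split=> //.
    + by rewrite mulf_div.
    + by split; apply: has_orderM.
    by rewrite !PoszD; ring.
  - move=> f f' z z' z'' _ _ ff0 [g [h [n [m [g0 h0 fE [gn hm] ->]]]]].
    move=> [g' [h' [n' [m' [g'0 h'0 f'E [gn' hm'] ->]]]]] ffz.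
    have E : f + f' = val (g * h' + g' * h) / val (h * h').
      by rewrite fE f'E addf_div // rmorphD !rmorphM.
    have s0 : val (g * h' + g' * h) != 0.
      by apply: contra_neq ff0; rewrite E => ->; rewrite mul0r.
    have [l sl] := has_order_exists s0.
    have -> : z'' = l%:Z - (m + m')%N%:Z.
      apply: has_ordU ffz _; exists (g * h' + g' * h), (h * h'), l, (m + m')%N.
      by split=> //; [rewrite rmorphM mulf_neq0 | split=> //; apply: has_orderM].
    have := has_orderD (has_orderM gn hm') (has_orderM gn' hm) sl.
    by rewrite geq_min ge_min; clear; lia.
  - move=> c c0; have v0 : val c%:P%:P != 0 by rewrite ev_const fmorph_eq0.
    have := has_ord_poly _ _ v0 (has_order_const c0). by rewrite ev_const.
  - have v0 := ev_coef_neq0 ffL q_gt1 N0; have [n Nn] := has_order_exists v0.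
    exists (val N%:P), n; split=> //; first exact: has_ord_poly.
    by rewrite eqz_nat (has_order_at0 Nn) ev_coef.
exists Q => g g0; have [n gn] := has_order_exists g0.
have E := has_ordU (QE _ g0) (has_ord_poly _ _ g0 gn).
by rewrite -(has_order_at0 gn) -lt0n -ltz_nat -(pmulr_lge0 _ d0) -(pmulr_lgt0 _ d0) E.
Qed.

End PlaceAtPoint.
(** * Elementary properties of places *)

Section PlaceTheory.

Variables (F L : fieldType) (iota : {rmorphism F -> L}) (Q : place iota).

Lemma ord1 : Q 1 = 0.
Proof. by rewrite -(rmorph1 iota) ord_atC ?oner_eq0. Qed.

Lemma ordV f : f != 0 -> Q f^-1 = - Q f.
Proof.
move=> f0; have := ord_atM Q f0 (invr_neq0 f0); rewrite divff // ord1 => /esym/eqP.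
by rewrite addrC addr_eq0 => /eqP.
Qed.

Lemma ord_div f g : f != 0 -> g != 0 -> Q (f / g) = Q f - Q g.
Proof. by move=> f0 g0; rewrite ord_atM ?invr_eq0 // ordV. Qed.

Lemma ordX f n : f != 0 -> Q (f ^+ n) = Q f * n%:Z.
Proof.
move=> f0; elim: n => [|n IH]; first by rewrite expr0 ord1 mulr0.
by rewrite exprS ord_atM ?expf_neq0 // IH -[n.+1]add1n PoszD mulrDr mulr1.
Qed.

Lemma ordN f : f != 0 -> Q (- f) = Q f.
Proof.
move=> f0; have m1 : (-1 : F) != 0 by rewrite oppr_eq0 oner_eq0.
by rewrite -mulN1r -(rmorphN1 iota) ord_atM ?ord_atC ?add0r // fmorph_eq0.
Qed.

Lemma ord_strict f g : f != 0 -> g != 0 -> Q f < Q g -> f + g != 0 /\ Q (f + g) = Q f.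
Proof.
move=> f0 g0 fg; have s0 : f + g != 0.
  by apply: contraTneq fg => /eqP; rewrite addr_eq0 => /eqP ->; rewrite ordN // ltxx.
split=> //; apply: le_anti; have := ord_atD Q f0 g0 s0.
rewrite min_l ?(ltW fg) // => ->; rewrite andbT leNgt; apply/negP => lt.
have := ord_atD Q s0 (_ : - g != 0); rewrite oppr_eq0 g0 addrK => /(_ isT f0).
by rewrite ordN // leNgt lt_min lt fg.
Qed.

(** Places leave the value at 0 unspecified; here 0 has infinite order. *)
Definition ord_ge (z : int) (f : L) : Prop := f = 0 \/ z <= Q f.

Lemma ord_geD z f g : ord_ge z f -> ord_ge z g -> ord_ge z (f + g).
Proof.
move=> [->|fz]; first by rewrite add0r.
move=> [->|gz]; first by rewrite addr0; right.
have [->|f0] := eqVneq f 0; first by rewrite add0r; right.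
have [->|g0] := eqVneq g 0; first by rewrite addr0; right.
have [->|s0] := eqVneq (f + g) 0; first by left.
by right; apply: le_trans (ord_atD Q f0 g0 s0); rewrite le_min fz.
Qed.

Lemma ord_geN z f : ord_ge z f -> ord_ge z (- f).
Proof.
have [->|f0] := eqVneq f 0; first by rewrite oppr0.
by case=> [/eqP|fz]; [rewrite (negPf f0) | right; rewrite ordN].
Qed.

Lemma ord_ge_sum z (I : Type) (s : seq I) (f : I -> L) :
  (forall i, ord_ge z (f i)) -> ord_ge z (\sum_(i <- s) f i).
Proof. by move=> fz; elim/big_ind: _ => //; [left | apply: ord_geD]. Qed.

Lemma ord_ge_constM z (c : F) f : ord_ge z f -> ord_ge z (iota c * f).
Proof.
have [->|c0] := eqVneq c 0; first by rewrite rmorph0 mul0r; left.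
have [->|f0] := eqVneq f 0; first by rewrite mulr0; left.
by case=> [/eqP|fz]; [rewrite (negPf f0) | right; rewrite ord_atM ?fmorph_eq0 // ord_atC // add0r].
Qed.

(** A term of strictly smallest order dominates the sum, so nothing cancels
when the orders are distinct. *)
Lemma ord_sum_distinct (I : eqType) (s : seq I) (f : I -> L) :
  uniq s -> (forall i, i \in s -> f i != 0) ->
  {in s &, injective (Q \o f)} -> s != [::] ->
  \sum_(i <- s) f i != 0 /\ exists2 i, i \in s &
    Q (\sum_(i <- s) f i) = Q (f i) /\ {in s, forall k, Q (f i) <= Q (f k)}.
Proof.
elim: s => // i s IH /= /andP[is_ us] fs inj _; rewrite big_cons.
have fi : f i != 0 by rewrite fs ?mem_head.
have [->|s0] := eqVneq s [::].
  rewrite big_nil addr0; split=> //; exists i; rewrite ?mem_head //; split=> //.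
  by move=> k; rewrite inE => /eqP ->.
have [||sum0 [k ks [sumE kmin]]] := IH us _ _ s0.
- by move=> k ks; rewrite fs // inE ks orbT.
- by move=> k l ks ls; apply: inj; rewrite inE ?ks ?ls orbT.
have [lt|lt|E] := ltgtP (Q (f i)) (Q (f k)).
- have [] := ord_strict fi sum0; first by rewrite sumE.
  move=> t0 tE; split=> //; exists i; rewrite ?mem_head //; split=> //.
  by move=> l; rewrite inE => /orP[/eqP -> // | /kmin]; apply: le_trans; apply: ltW.
- have [] := @ord_strict _ _ sum0 fi; first by rewrite sumE.
  rewrite addrC sumE => t0 tE; split=> //; exists k; rewrite ?inE ?ks ?orbT //; split=> //.
  by move=> l; rewrite inE => /orP[/eqP -> | /kmin //]; apply: ltW.
have : i = k by apply: inj; rewrite ?mem_head // inE ks orbT.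
by move=> ik; rewrite ik ks in is_.
Qed.

End PlaceTheory.

(** * The place at infinity *)

Section Infinity.

Variables (F L : fieldType) (iota : {rmorphism F -> L}).
Implicit Types g h : {poly {poly F}}.

(** In the chart at infinity the coordinates are [x/y] and [1/y], and a power
of [y] clears the denominators.  The polynomial [h] does not depend on the
point: it will be used at [(x, y)] and at [(x/y, 1/y)]. *)
Lemma homogenization g : exists N h, forall a b : L, b != 0 ->
  ev iota (a / b) b^-1 g * b ^+ N = ev iota a b h.
Proof.
have closedD g1 g2 : (exists N h, forall a b : L, b != 0 ->
    ev iota (a / b) b^-1 g1 * b ^+ N = ev iota a b h) ->
    (exists N h, forall a b : L, b != 0 ->
    ev iota (a / b) b^-1 g2 * b ^+ N = ev iota a b h) ->
    exists N h, forall a b : L, b != 0 ->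
    ev iota (a / b) b^-1 (g1 + g2) * b ^+ N = ev iota a b h.
  move=> [N1 [h1 E1]] [N2 [h2 E2]]; exists (N1 + N2)%N, (h1 * 'X^N2 + h2 * 'X^N1) => a b b0.
  rewrite rmorphD [in RHS]rmorphD !rmorphM !rmorphXn /= !ev_Y -E1 // -E2 // exprD; ring.
elim/poly_ind: g => [|g p [N [h E]]].
  by exists 0%N, 0 => a b _; rewrite !rmorph0 mul0r.
apply: (closedD).
  exists N.+1, h => a b b0; rewrite rmorphM /= ev_Y -E // exprS; field.
  exact: b0.
elim/poly_ind: p {g h N E} => [|p c [N [h E]]].
  by exists 0%N, 0 => a b _; rewrite !rmorph0 mul0r.
rewrite polyCD polyCM; apply: (closedD).
  exists N.+1, (h * 'X%:P) => a b b0; rewrite !rmorphM /= !ev_X -E // exprS; field.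
  exact: b0.
by exists 0%N, c%:P%:P => a b _; rewrite !ev_const mulr1.
Qed.

Variables (x y : L) (q : nat).
Hypothesis ffL : hermitian_function_field iota x y q.
Hypothesis q_gt1 : (1 < q)%N.

Lemma swap_curve : y^-1 ^+ q + y^-1 = (x / y) ^+ q.+1.
Proof.
have y0 := y_neq0 ffL q_gt1; have := ev_curve ffL; rewrite expr_div_n => <-.
rewrite exprVn exprS; field.
by rewrite expf_neq0 y0.
Qed.

(** The map [(x, y) -> (x/y, 1/y)] is an involution of the curve that swaps
[P_oo] and the origin.  If [g] vanishes at [(x/y, 1/y)], its homogenization [h]
vanishes at [(x, y)], hence is a multiple of the equation of the curve; then [h]
also vanishes at [(x/y, 1/y)], where its value is [g(x, y)] up to a power of
[y]. *)
Lemma swap_function_field : hermitian_function_field iota (x / y) y^-1 q.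
Proof.
have y0 := y_neq0 ffL q_gt1; have yV0 : y^-1 != 0 by rewrite invr_eq0.
have xE : x = (x / y) / y^-1 by rewrite invrK divfK.
have evalE g : exists N h, ev iota x y g = ev iota (x / y) y^-1 h * y ^+ N.
  have [N [h E]] := homogenization g; exists N, h.
  by rewrite -E // -xE invrK exprVn mulfVK ?expf_neq0.
split=> [g|f].
  rewrite -[fun_of_poly _ _ _ g]/(ev iota (x / y) y^-1 g); split.
    move=> g0; apply/(ev_eq0 ffL); have [N [h E]] := homogenization g.
    have /(ev_eq0 ffL)[k hE] : ev iota x y h = 0 by rewrite -E // g0 mul0r.
    have := E (x / y) y^-1 yV0; rewrite -xE invrK hE rmorphM /= ev_hermitian swap_curve subrr mulr0.
    by move=> /eqP; rewrite mulf_eq0 expf_eq0 (negPf yV0) andbF orbF => /eqP.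
  by case=> k ->; rewrite rmorphM /= ev_hermitian swap_curve subrr mulr0.
have [g [h []]] := ffL.2 f.
rewrite -[fun_of_poly _ _ _ g]/(ev iota x y g) -[fun_of_poly _ _ _ h]/(ev iota x y h).
have [[N [g' ->]] [M [h' ->]]] := (evalE g, evalE h) => h0 ->.
exists (g' * 'X^M), (h' * 'X^N).
rewrite -[fun_of_poly _ _ _ (g' * _)]/(ev iota (x / y) y^-1 _).
rewrite -[fun_of_poly _ _ _ (h' * _)]/(ev iota (x / y) y^-1 _).
move: h0; rewrite mulf_eq0 negb_or => /andP[h0 _].
rewrite !rmorphM !rmorphXn /= !ev_Y mulf_neq0 ?expf_neq0 // !exprVn; split=> //.
by field; rewrite h0 !expf_neq0.
Qed.

Lemma Pinf_exists : [pchar F].-nat q -> exists Q : place iota, is_Pinf x y Q.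
Proof.
move=> q_pchar; have q0 : (0 < q)%N by rewrite ltnW.
have c0 : (0 : F) ^+ q + 0 = 0 ^+ q.+1 by rewrite !expr0n eqn0Ngt q0 addr0.
have r0 : root (map_poly (idfun : {rmorphism F -> F}) 'X) 0.
  by rewrite map_polyX rootX.
have [|Q QE] := place_at_point swap_function_field q_gt1 q_pchar c0 _ r0.
  by rewrite polyX_eq0.
have y0 := y_neq0 ffL q_gt1; have x0 := x_neq0 ffL q_gt1.
exists Q; apply/andP; split.
  have := (QE 'X%:P); rewrite !ev_X eqxx => /(_ _)[]//.
  by rewrite mulf_neq0 ?invr_eq0.
by have := (QE 'X); rewrite !ev_Y eqxx invr_eq0 => /(_ y0)[].
Qed.

Section OrderAtInfinity.

Variable Q : place iota.

(** When [y] has a pole, [y^q] dominates [y^q + y = x^(q+1)], so that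
[q Q(y) = (q + 1) Q(x)]; the integers [q] and [q + 1] are coprime.  The factor
[k] is shown to be 1 only later, in [Pinf_coords]. *)
Lemma ord_affine_coords : Q y < 0 \/ Q x < 0 ->
  exists2 k : int, 0 < k & Q x = - (q%:Z * k) /\ Q y = - (q.+1%:Z * k).
Proof.
have y0 := y_neq0 ffL q_gt1; have x0 := x_neq0 ffL q_gt1.
have yq0 : y ^+ q != 0 by rewrite expf_neq0.
have C := ev_curve ffL.
have s0 : y ^+ q + y != 0 by rewrite C expf_neq0.
have Qx : Q (y ^+ q + y) = Q x * q.+1%:Z by rewrite C ordX.
case: (ltP (Q y) 0) => [Qy _|Qy [//|Qx0]]; last first.
  have := ord_atD Q yq0 y0 s0; rewrite Qx ordX // leNgt lt_min.
  by rewrite (lt_le_trans _ Qy) ?(lt_le_trans _ (mulr_ge0 Qy _)) ?nmulr_rlt0.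
have [|_] := ord_strict (Q := Q) yq0 y0; first by rewrite ordX // -[ltRHS]mulr1 ltr_nM2l // (ltz_nat 1).
rewrite Qx ordX // -addn1 PoszD mulrDr mulr1 => /(canRL (addKr _)) E.
have xE : Q x = - (q%:Z * (Q x - Q y)) by rewrite [LHS]E; ring.
exists (Q x - Q y).
  have : Q y = - ((q%:Z + 1) * (Q x - Q y)) by rewrite mulrDl opprD -xE; ring.
  by move=> yE; move: Qy; rewrite {1}yE oppr_lt0 pmulr_rgt0 // ltr_wpDl.
by split=> //; rewrite mulrDl opprD -xE; ring.
Qed.

(** The monomials [x^i y^l] with [l < q] have distinct orders
[- (i q + l (q + 1)) k], hence the order of the sum is that of the monomial of
largest weight [w]. *)
Lemma ord_reduced (k : int) g : 0 < k -> Q x = - (q%:Z * k) -> Q y = - (q.+1%:Z * k) ->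
  (size g <= q)%N -> g != 0 -> exists2 w : nat, Q (ev iota x y g) = - (w%:Z * k) &
    forall i l, g`_l`_i != 0 -> (i * q + l * q.+1 <= w)%N.
Proof.
move=> k0 Qx Qy gq g0; have [m gm] := coef_size_bound g.
have y0 := y_neq0 ffL q_gt1; have x0 := x_neq0 ffL q_gt1.
pose T := ('I_q * 'I_m)%type.
pose c (u : T) := g`_u.1`_u.2.
pose f (u : T) := iota (c u) * x ^+ u.2 * y ^+ u.1.
pose s := [seq u <- index_enum T | c u != 0].
have fE : ev iota x y g = \sum_(u <- s) f u.
  rewrite (ev_box _ _ _ gq gm) pair_bigA big_filter [LHS](bigID (fun u => c u != 0)) /=.
  rewrite [X in _ + X]big1 ?addr0 // => u; rewrite negbK /c => /eqP ->.
  by rewrite rmorph0 !mul0r.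
have cs u : (u \in s) = (c u != 0) by rewrite mem_filter mem_index_enum andbT.
have f0 u : u \in s -> f u != 0.
  by rewrite cs => cu; rewrite !mulf_neq0 ?expf_neq0 ?fmorph_eq0.
pose W (u : T) := (u.2 * q + u.1 * q.+1)%N.
have Qf u : u \in s -> Q (f u) = - ((W u)%:Z * k).
  rewrite cs => cu; rewrite !ord_atM ?mulf_neq0 ?expf_neq0 ?fmorph_eq0 //.
  by rewrite ord_atC // !ordX // Qx Qy /W !PoszD !PoszM; ring.
have Wc i l : g`_l`_i != 0 -> exists2 u, u \in s & W u = (i * q + l * q.+1)%N.
  move=> gli.
  have lq : (l < q)%N.
    by rewrite ltnNge; apply: contra gli => ql; rewrite (nth_default _ (leq_trans gq ql)) coef0.
  have im : (i < m)%N.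
    by rewrite ltnNge; apply: contra gli => mi; rewrite nth_default // (leq_trans (gm l) mi).
  by exists (Ordinal lq, Ordinal im); rewrite ?cs.
have [| | | |_ [u us [Qu umin]]] := @ord_sum_distinct _ _ _ Q _ s f.
- by rewrite filter_uniq // index_enum_uniq.
- exact: f0.
- move=> u v us vs /=; rewrite !Qf // => /oppr_inj/(mulIf (lt0r_neq0 k0))[].
  (* Reducing the weight modulo q recovers the exponent of y. *)
  rewrite /W !mulnS !addnA => E.
  have l_eq : u.1 = v.1 :> nat.
    have := congr1 (modn^~ q) E; rewrite -!addnA ![(_ * q + _)%N]addnC -!addnA.
    by rewrite -!mulnDl ![(_ + _ * q)%N]addnC !modnMDl !modn_small.
  have i_eq : u.2 = v.2 :> nat.
    by move: E; rewrite l_eq => /addIn/addIn/eqP; rewrite eqn_pmul2r ?(ltnW q_gt1) // => /eqP.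
  by case: u v l_eq i_eq {us vs E} => u1 u2 [v1 v2] /= /val_inj -> /val_inj ->.
- apply: contra_neq g0 => s0; apply/polyP => l; apply/polyP => i; rewrite !coef0.
  by apply/eqP; apply/idPn => /Wc[u]; rewrite s0.
exists (W u); first by rewrite fE Qu Qf.
move=> i l /Wc[v vs <-]; have := umin v vs.
by rewrite !Qf // lerN2 ler_pM2r // lez_nat.
Qed.

(** By [ord_reduced] the factor [k] divides the order of every function, and
some function has order 1. *)
Lemma Pinf_coords : is_Pinf x y Q -> Q x = - q%:Z /\ Q y = - q.+1%:Z.
Proof.
move=> /andP[_]; have y0 := y_neq0 ffL q_gt1.
rewrite ordV // oppr_gt0 => Qy.
have [k k0 [Qxk Qyk]] := ord_affine_coords (or_introl Qy).
have kdvd h : ev iota x y h != 0 -> exists w : int, Q (ev iota x y h) = w * k.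
  move=> h0; have [h' h'q hE] := reduction ffL q_gt1 h.
  have [|w Qw _] := ord_reduced k0 Qxk Qyk h'q.
    by apply: contra_neq h0 => h'0; rewrite -hE h'0 rmorph0.
  by exists (- w%:Z); rewrite -hE Qw mulNr.
have [t t0 Qt] := ord_at_normalized Q.
have [g [h [h0 tE]]] := ffL.2 t.
rewrite -[fun_of_poly _ _ _ g]/(ev iota x y g) -[fun_of_poly _ _ _ h]/(ev iota x y h) in h0 tE.
have g0 : ev iota x y g != 0 by apply: contra_neq t0 => g0; rewrite tE g0 mul0r.
have [[w Qg] [w' Qh]] := (kdvd g g0, kdvd h h0).
suff k1 : k = 1 by rewrite Qxk Qyk k1 !mulr1.
move: Qt; rewrite tE ord_div // Qg Qh -mulrBl => wk.
have : (k %| (w - w')%R * k)%Z by rewrite dvdz_mull.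
by rewrite wk dvdz1; case: k k0 {Qxk Qyk kdvd Qg Qh wk} => // n _ /eqP /= ->.
Qed.

End OrderAtInfinity.

Lemma affine_coords_regular (Q : place iota) : ~~ is_Pinf x y Q -> 0 <= Q x /\ 0 <= Q y.
Proof.
have y0 := y_neq0 ffL q_gt1; have x0 := x_neq0 ffL q_gt1 => nQ.
have [neg|] := boolP ((Q y < 0) || (Q x < 0)); last by rewrite negb_or -!leNgt => /andP[].
case/negP: nQ; have [k k0 [Qx Qy]] := ord_affine_coords (orP neg).
rewrite /is_Pinf ord_div // ordV // Qx Qy -addn1 PoszD opprK.
by apply/andP; split; nia.
Qed.

End Infinity.

(** * Functions regular at all affine places *)

Section Regular.

Variables (F L : fieldType) (iota : {rmorphism F -> L}) (x y : L) (q : nat).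
Hypothesis ffL : hermitian_function_field iota x y q.
Hypothesis q_gt1 : (1 < q)%N.
Hypothesis q_pchar : [pchar F].-nat q.
Variables (K : closedFieldType) (j : {rmorphism F -> K}).
Notation val := (ev iota x y).

(** The polynomial [Y^q + Y - a^(q+1)] is separable, since its derivative is
1; it has too many roots for all of them to be roots of [p]. *)
Lemma fibre_nonroot (a : K) (p : {poly K}) : p != 0 -> (size p <= q)%N ->
  exists2 b, b ^+ q + b = a ^+ q.+1 & p.[b] != 0.
Proof.
move=> p0 pq; pose E : {poly K} := 'X^q + ('X - (a ^+ q.+1)%:P).
have sE : size E = q.+1.
  by rewrite size_polyDl ?size_polyXn // size_XsubC.
have mE : E \is monic.
  by rewrite monicE lead_coefDl ?lead_coefXn // size_polyXn size_XsubC.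
have q0 : (q%:R : {poly K}) = 0.
  have [] : exists2 p : nat, p \in [pchar F] & (p %| q)%N.
    have q1 : q != 1%N by rewrite neq_ltn q_gt1 orbT.
    exists (pdiv q); last exact: pdiv_dvd.
    by apply: (pnatPpi q_pchar); rewrite pi_pdiv.
  move=> r rF /dvdnP[n ->]; rewrite natrM.
  by rewrite (pcharf0 (rmorph_pchar (@polyC K) (rmorph_pchar j rF))) mulr0.
have dE : E^`() = 1.
  by rewrite derivD derivXn derivXsubC -mulr_natr q0 mulr0 add0r.
have [s Es] := closed_field_poly_normal E.
rewrite (monicP mE) scale1r in Es.
have us : uniq s.
  by rewrite -separable_prod_XsubC -Es unlock dE coprimep1.
have [/(max_poly_roots p0)/(_ us)|] := boolP (all (root p) s).
  have : size E = (size s).+1 by rewrite Es size_prod_XsubC.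
  by rewrite sE => -[<-]; rewrite ltnNge pq.
case/allPn => b bs; rewrite rootE => pb; exists b => //.
have : root E b by rewrite Es root_prod_XsubC.
rewrite rootE hornerD hornerXn hornerXsubC addrA subr_eq0 => /eqP.
exact.
Qed.

(** Induction on the degree of a denominator [N(x)] of [f].  If [g] is the
numerator and [g(a, Y)] is nonzero for some root [a] of [N], then [f] has a pole
at a point of abscissa [a]; otherwise [N] and all the coefficients of [g] have a
common factor, which cancels. *)
Lemma regular_is_polynomial f :
  (forall Q : place iota, ~~ is_Pinf x y Q -> ord_ge Q 0 f) -> exists g, val g = f.
Proof.
move=> freg.
have [g [N [N0 fE]]] : exists g (N : {poly F}), N != 0 /\ f * val N%:P = val g.
  have [g [h [h0 fE]]] := ffL.2 f; have [u [N [N0 uE]]] := elimination ffL q_gt1 h0.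
  exists (u * g), N; split=> //; rewrite -uE !rmorphM /= fE.
  rewrite -[fun_of_poly _ _ _ g]/(val g) -[fun_of_poly _ _ _ h]/(val h) in h0 *.
  by field.
have [n] := ubnP (size N); elim: n g N N0 fE => // n IH g0 N N0 fE; rewrite ltnS => Nn.
have [g gq gE] := reduction ffL q_gt1 g0; rewrite -gE in fE.
have valN0 := ev_coef_neq0 ffL q_gt1 N0.
have [sN|/closed_rootP[a Na]] := eqVneq (size (map_poly j N)) 1.
  move: sN; rewrite size_map_poly => /eqP/size_poly1P[c c0 NE].
  exists (c^-1%:P%:P * g); rewrite rmorphM /= -fE NE !ev_const.
  by rewrite mulrCA fmorphV mulVf ?fmorph_eq0 // mulr1.
pose ga : {poly K} := map_poly (fun p => (map_poly j p).[a]) g.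
have gaE b : ga.[b] = ev j a b g.
  rewrite /ev /eval2 [_.[b%:P]](@horner_coef_wide _ q) ?(leq_trans (size_poly _ _)) //.
  rewrite (@horner_coef_wide _ q) ?(leq_trans (size_poly _ _)) // horner_sum.
  by apply: eq_bigr => k _; rewrite hornerM horner_exp hornerC !coef_map_id0 ?rmorph0 ?horner0.
have [ga0|ga0] := eqVneq ga 0; last first.
  have [|b bc gb] := fibre_nonroot a ga0; first by rewrite (leq_trans (size_poly _ _)).
  rewrite gaE in gb.
  have [Q QE] := place_at_point ffL q_gt1 q_pchar bc N0 Na.
  have [_] := QE _ valN0; rewrite (ev_coef j) (eqP Na) eqxx => QN.
  have g0' : val g != 0.
    apply: contra_neq gb => /(ev_eq0 ffL)[k ->].
    by rewrite rmorphM /= ev_hermitian bc subrr mulr0.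
  have f0 : f != 0 by apply: contra_neq g0' => f0; rewrite -fE f0 mul0r.
  have [Qg] := QE _ g0'; rewrite (negPf gb) => Qg'.
  case: (freg Q) => [|/eqP|].
  - have y0 := y_neq0 ffL q_gt1.
    rewrite /is_Pinf (ordV _ y0) negb_and -!leNgt oppr_le0.
    by have := (QE 'X); rewrite ev_Y => /(_ y0)[->]; rewrite orbT.
  - by rewrite (negPf f0).
  move=> Qf; have : Q (val g) = Q f + Q (val N%:P) by rewrite -fE ord_atM.
  move=> E; move: Qg'; rewrite E ltr_wpDl //. 
have [D [sD DN Dg]] : exists D : {poly F}, [/\ size D != 1%N, D %| N & forall k, D %| g`_k].
  pose D := foldr (@gcdp F) N g.
  have [DN Dg] : D %| N /\ forall p, p \in (g : seq _) -> D %| p.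
    rewrite /D; elim: (g : seq _) => //= p s [sN sp]; split.
      exact: dvdp_trans (dvdp_gcdr _ _) sN.
    move=> r; rewrite inE => /orP[/eqP ->|/sp]; first exact: dvdp_gcdl.
    exact/dvdp_trans/dvdp_gcdr.
  have Da : root (map_poly j D) a.
    have : all (fun p => root (map_poly j p) a) g.
      apply/(all_nthP 0) => k kg; move/(congr1 (fun p : {poly K} => p`_k)): ga0.
      by rewrite coef_map_id0 ?rmorph0 ?horner0 // coef0 => /eqP.
    rewrite /D; elim: (g : seq _) => //= p s IHs /andP[pa /IHs sa].
    by rewrite gcdp_map root_gcd pa.
  exists D; split=> //.
    apply: contraL Da; rewrite -(size_map_poly j) => /size_poly1P[c c0 ->].
    by rewrite rootC.
  move=> k; have [kg|kg] := ltnP k (size g); first by apply: Dg; apply: mem_nth.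
  by rewrite nth_default // dvdp0.
have D0 : D != 0 by apply: contraNneq N0 => D0; rewrite D0 dvd0p in DN.
have valD0 := ev_coef_neq0 ffL q_gt1 D0.
pose g' : {poly {poly F}} := map_poly (fun p => p %/ D) g.
have gD : g = D%:P * g'.
  apply/polyP => k; rewrite coefCM coef_map_id0 ?div0p // mulrC divpK //.
have ND : N = D * (N %/ D) by rewrite mulrC divpK.
have N'0 : N %/ D != 0 by apply: contra_neq N0 => E; rewrite ND E mulr0.
apply: (IH g' (N %/ D)) => //.
  apply: (mulfI valD0); rewrite mulrCA -!(rmorphM (ev iota x y)) /= -polyCM -ND -gD.
  exact: fE.
rewrite (leq_trans _ Nn) // size_divp // ltn_subrL size_poly_gt0 N0 andbT.
by move: sD D0; rewrite -size_poly_gt0; case: (size D) => [|[]].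
Qed.

End Regular.
(** * The trace to the subfield *)

Section PowerTrace.

Variables (r n : nat).

(** For [n] the degree of the extension of [F_r] this is the trace of a
finite field; it is also applied to polynomials and to functions. *)
Definition power_trace (R : nzRingType) (z : R) : R := \sum_(i < n) z ^+ (r ^ i).

Lemma rmorph_power_trace (R S : nzRingType) (f : {rmorphism R -> S}) z :
  f (power_trace z) = power_trace (f z).
Proof. by rewrite rmorph_sum; apply: eq_bigr => i _; rewrite rmorphXn. Qed.

Variable R : comNzRingType.
Hypothesis r_pchar : [pchar R].-nat r.

Let rX_pchar i : [pchar R].-nat (r ^ i)%N.
Proof. by rewrite pnatX r_pchar. Qed.

Lemma power_traceD (z w : R) : power_trace (z + w) = power_trace z + power_trace w.
Proof.
by rewrite -big_split; apply: eq_bigr => i _; rewrite exprDn_pchar // rX_pchar.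
Qed.

Lemma power_trace_frobenius (z : R) :
  power_trace z ^+ r - power_trace z = z ^+ (r ^ n) - z.
Proof.
have -> : power_trace z ^+ r = \sum_(i < n) z ^+ (r ^ i.+1).
  have r0 : (0 < r)%N by case/andP: r_pchar.
  rewrite /power_trace; elim/big_rec2: _ => [|i u v _ <-].
    by rewrite expr0n eqn0Ngt r0.
  by rewrite exprDn_pchar // -exprM expnSr.
rewrite -sumrB -(big_mkord xpredT (fun i => z ^+ (r ^ i.+1) - z ^+ (r ^ i))).
by rewrite telescope_sumr // expn0 expr1.
Qed.

End PowerTrace.

Lemma power_trace0 r n (R : nzRingType) : (0 < r)%N -> power_trace r n (0 : R) = 0.
Proof.
by move=> r0; apply: big1 => i _; rewrite expr0n eqn0Ngt expn_gt0 r0.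
Qed.

Lemma frobenius_fixed (K : finFieldType) (E : fieldType) (f : {rmorphism K -> E}) w :
  w ^+ #|K| = w -> exists c, w = f c.
Proof.
move=> wK; have := congr1 (fun p => (map_poly f p).[w]) (finField_genPoly K).
rewrite rmorphB /= map_polyXn map_polyX hornerD hornerN hornerXn hornerX wK subrr.
rewrite rmorph_prod horner_prod => /esym/eqP; rewrite prodf_seq_eq0 => /hasP[c _ /=].
by rewrite map_polyXsubC hornerXsubC subr_eq0 => /eqP; exists c.
Qed.

(** The dimension of a code over a finite field can be read off the number
of its words. *)
Lemma vspace_of_closed_set (K : finFieldType) (n : nat) (S : {set 'rV[K]_n}) :
  0 \in S -> (forall k u v, u \in S -> v \in S -> k *: u + v \in S) ->
  exists2 V : {vspace 'rV[K]_n}, V =i S & #|S| = (#|K| ^ \dim V)%N.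
Proof.
move=> S0 SD; pose V := <<enum S>>%VS.
have VS : V =i S.
  move=> c; apply/idP/idP => [cV|cS]; last by rewrite memv_span // mem_enum.
  rewrite (coord_span (X := in_tuple (enum S)) cV).
  elim/big_rec: _ => // i u _ uS; apply: SD => //.
  by rewrite -mem_enum mem_nth.
by exists V => //; rewrite -card_vspace; apply: eq_card.
Qed.

(** * Rational points of the curve *)

Section HermitianPoints.

Variables (F : finFieldType) (q : nat).
Hypothesis q_gt1 : (1 < q)%N.
Hypothesis card_F : #|F| = (q ^ 2)%N.
Variable P : 'I_(q ^ 3) -> F * F.
Hypothesis P_inj : injective P.
Hypothesis P_points : forall ab : F * F, on_curve q ab <-> exists i, P i = ab.
Implicit Types g h : {poly {poly F}}.
Notation evF := (ev (idfun : {rmorphism F -> F})).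

Lemma evF_eval2 (a b : F) g : evF a b g = eval2 a b g.
Proof.
by rewrite /ev map_poly_id // => p _; apply: map_poly_id.
Qed.

Lemma on_curveE (a b : F) : on_curve q (a, b) <-> b ^+ q + b = a ^+ q.+1.
Proof.
rewrite /on_curve -evF_eval2 ev_hermitian; split=> [/eqP|->]; last exact: subrr.
by rewrite subr_eq0 => /eqP.
Qed.

Definition fibre (a : F) : {set F} := [set b | b ^+ q + b == a ^+ q.+1].

(** A fibre has at most [q] points, as the zero set of a polynomial of degree
[q]; as the [q^2] fibres have [q^3] points in total, each has exactly [q]. *)
Lemma card_fibre (a : F) : #|fibre a| = q.
Proof.
have Bq c : (#|fibre c| <= q)%N.
  pose E : {poly F} := 'X^q + ('X - (c ^+ q.+1)%:P).
  have sE : size E = q.+1 by rewrite size_polyDl ?size_polyXn // size_XsubC.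
  rewrite -ltnS -sE cardE; apply: max_poly_roots; last exact: enum_uniq.
    by rewrite -size_poly_eq0 sE.
  apply/allP => b; rewrite mem_enum inE rootE hornerD hornerXn hornerXsubC addrA.
  by rewrite subr_eq0.
have total : (\sum_c #|fibre c| = \sum_(c : F) q)%N.
  rewrite sum_nat_const card_F -expnSr -(card_ord (q ^ 3)) -(card_codom P_inj).
  under eq_bigr do rewrite -sum1_card.
  rewrite pair_big_dep /= -sum1_card; apply: eq_bigl => -[c b] /=.
  rewrite inE; apply/idP/idP => [/eqP/on_curveE/P_points[i <-]|]; first exact: codom_f.
  by move=> /codomP[i cb]; apply/eqP/on_curveE/P_points; exists i.
have := leqif_sum (fun c (_ : xpredT c) => leqif_eq (Bq c)).
by case=> _; rewrite total eqxx => /esym/forall_inP/(_ a isT)/eqP.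
Qed.

Lemma fibre_point (a : F) : exists i, (P i).1 = a.
Proof.
have : (0 < #|fibre a|)%N by rewrite card_fibre ltnW.
case/card_gt0P => b; rewrite inE => /eqP/on_curveE/P_points[i Pi].
by exists i; rewrite Pi.
Qed.

(** For each [a], the polynomial [g(a, Y)] of degree less than [q] has the
[q] points of the fibre as roots, so it is zero; hence each coefficient of [g],
of degree less than [q^2], vanishes on [F]. *)
Lemma reduced_vanishing g : (size g <= q)%N -> (forall l, (size (g`_l)%R <= q ^ 2)%N) ->
  (forall i, evF (P i).1 (P i).2 g = 0) -> g = 0.
Proof.
move=> gq gF g0.
have ga a : map_poly (horner_eval a) g = 0.
  apply/eqP/idPn => ga0.
  have roots_a : all (root (map_poly (horner_eval a) g)) (enum (fibre a)).
    apply/allP => b; rewrite mem_enum inE => /eqP/on_curveE/P_points[i Pi].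
    have := g0 i; rewrite Pi /= evF_eval2 /eval2 => gab; apply/eqP.
    by rewrite -[in RHS]gab -[RHS]/(horner_eval a _) -horner_map /= /horner_eval hornerC.
  have := max_poly_roots ga0 roots_a (enum_uniq _).
  by rewrite -cardE card_fibre ltnNge (leq_trans (size_poly _ _)).
apply/polyP => l; rewrite coef0; apply/eqP/idPn => gl0.
have roots_l : all (root g`_l) (enum F).
  apply/allP => a _; apply/eqP; have := congr1 (fun p : {poly F} => p`_l) (ga a).
  by rewrite coef_map coef0.
by have := max_poly_roots gl0 roots_l (enum_uniq _); rewrite -cardE card_F ltnNge gF.
Qed.

End HermitianPoints.
(** * The subfield subcodes *)

Section SubfieldSubcode.

Variables (p e r m q : nat).
Hypotheses (p_prime : prime p) (e_gt0 : (0 < e)%N) (r_def : r = (p ^ e)%N).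
Hypotheses (m_ge1 : (1 <= m)%N) (q_def : q = (r ^ m)%N).
Variables (Fr F : finFieldType).
Hypotheses (card_Fr : #|Fr| = r) (card_F : #|F| = (q ^ 2)%N).
Variable emb : {rmorphism Fr -> F}.
Variables (L : fieldType) (iota : {rmorphism F -> L}) (x y : L).
Hypothesis ffL : hermitian_function_field iota x y q.
Variable P : 'I_(q ^ 3) -> F * F.
Hypothesis P_inj : injective P.
Hypothesis P_points : forall ab : F * F, on_curve q ab <-> exists i, P i = ab.
Implicit Types (g h : {poly {poly F}}) (a : F) (k : Fr).
Notation val := (ev iota x y).
Notation evF := (ev (idfun : {rmorphism F -> F})).

Lemma r_gt1 : (1 < r)%N.
Proof. by rewrite r_def -(exp1n e) ltn_exp2r // prime_gt1. Qed.

Lemma r_gt0 : (0 < r)%N. Proof. exact: ltnW r_gt1. Qed.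

Lemma q_gt1 : (1 < q)%N.
Proof. by rewrite q_def -(exp1n m) ltn_exp2r // r_gt1. Qed.

Lemma q_gt0 : (0 < q)%N. Proof. exact: ltnW q_gt1. Qed.

Lemma r_pchar : [pchar F].-nat r.
Proof.
have pF : p \in [pchar F].
  apply: (@card_finPcharP _ _ (e * m * 2)) => //.
  by rewrite card_F q_def r_def !expnM.
by rewrite r_def pnatX pnatE ?pF.
Qed.

Lemma q_pchar : [pchar F].-nat q.
Proof. by rewrite q_def pnatX r_pchar. Qed.

Lemma qq_def : (q ^ 2 = r ^ (2 * m))%N.
Proof. by rewrite q_def -expnM mulnC. Qed.

Lemma r_dvd_q3 : (r %| q ^ 3)%N.
Proof. by rewrite q_def -expnM -[X in (X %| _)%N]expn1 dvdn_exp2l // muln_gt0 m_ge1. Qed.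

Lemma riemann_rochE s f : riemann_roch (sPinf (iota := iota) x y s) f <->
  forall Q : place iota, ord_ge Q (- (if is_Pinf x y Q then s%:Z else 0)) f.
Proof.
split=> [[->|[f0 fs]] Q|fs]; first by left.
  by right; apply: fs.
have [->|f0] := eqVneq f 0; first by left.
by right; split=> // Q; case: (fs Q) => // /eqP; rewrite (negPf f0).
Qed.

Lemma point_curve i : (P i).2 ^+ q + (P i).2 = (P i).1 ^+ q.+1.
Proof. by apply/on_curveE/P_points; exists i; case: (P i). Qed.

Lemma value_at_poly g i c : value_at iota x y (val g) (P i) c <-> c = evF (P i).1 (P i).2 g.
Proof.
split=> [[g1 [h1 [h10 gE ->]]]|->]; last first.
  exists g, 1; rewrite -!evF_eval2 !rmorph1 divr1 oner_neq0; split=> //.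
  by rewrite -[fun_of_poly _ _ _ 1]/(val 1) rmorph1 divr1.
rewrite -[fun_of_poly _ _ _ g1]/(val g1) -[fun_of_poly _ _ _ h1]/(val h1) in gE.
rewrite -!evF_eval2 in h10 *.
have val_h1 : val h1 != 0.
  apply: contra_neq h10 => h0.
  by rewrite (ev_curve_congr ffL (idfun : {rmorphism F -> F}) (h := 0) _ (point_curve i)) ?rmorph0.
have gh1 : val (g * h1) = val g1 by rewrite rmorphM /= gE divfK.
rewrite -(ev_curve_congr ffL (idfun : {rmorphism F -> F}) gh1 (point_curve i)).
by rewrite rmorphM mulfK.
Qed.

(** The function [T(a x) + k].  It does not involve [y]. *)
Definition trace_fun a k : {poly {poly F}} :=
  (power_trace r (2 * m) (a *: 'X) + (emb k)%:P)%:P.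

Lemma ev_trace_fun (R : comNzRingType) (j : {rmorphism F -> R}) b c a k :
  ev j b c (trace_fun a k) = power_trace r (2 * m) (j a * b) + j (emb k).
Proof.
rewrite ev_coef rmorphD /= map_polyC hornerD hornerC; congr (_ + _).
rewrite rmorph_power_trace -[LHS]/(horner_eval b _) rmorph_power_trace.
by rewrite /= map_polyZ map_polyX /horner_eval /= hornerZ hornerX.
Qed.

(** The pole order of [(a x)^(r^i)] is [q r^i], and [i < 2 m] with
[r^(2 m) = q^2]. *)
Lemma trace_fun_in_riemann_roch a k s : a = 0 \/ s = (q ^ 3 %/ r)%N ->
  riemann_roch (sPinf (iota := iota) x y s) (val (trace_fun a k)).
Proof.
move=> as_; apply/riemann_rochE => Q; rewrite ev_trace_fun.
have x0 := x_neq0 ffL q_gt1.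
apply: ord_geD; last first.
  have [->|k0] := eqVneq k 0; first by left; rewrite !rmorph0.
  by right; rewrite ord_atC ?fmorph_eq0 // oppr_le0; case: ifP.
apply: ord_ge_sum => i; case: as_ => [->|->].
  by left; rewrite rmorph0 mul0r expr0n eqn0Ngt expn_gt0 r_gt0.
rewrite exprMn -rmorphXn /=; apply: ord_ge_constM; right; rewrite ordX //.
case: ifPn => Qinf; last first.
  have [Qx _] := affine_coords_regular ffL q_gt1 Qinf.
  by rewrite oppr0 mulr_ge0.
have [-> _] := Pinf_coords ffL q_gt1 Qinf.
rewrite mulNr lerN2 -PoszM lez_nat leq_divRL ?r_gt0 // -mulnA -expnSr.
by rewrite [(q ^ 3)%N]expnS leq_pmul2l ?q_gt0 // qq_def leq_pexp2l ?r_gt0.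
Qed.

(** The weights of the monomials of [f^r - f] are at most [s r <= q^3]; the
only such monomial with [x]-degree at least [q^2] is [x^(q^2)].  Subtracting
the multiple of [x^(q^2) - x] with the same coefficient leaves a reduced
polynomial that vanishes at all the points.  Then [f - T(a x)] is fixed by the
[r]-th power map. *)
Lemma trace_fun_of_code s f c : (s * r <= q ^ 3)%N ->
  riemann_roch (sPinf (iota := iota) x y s) f ->
  (forall i, value_at iota x y f (P i) (emb (c i))) ->
  exists a k, f = val (trace_fun a k) /\ ((s * r < q ^ 3)%N -> a = 0).
Proof.
move=> srq /riemann_rochE fs fP.
have [K [j _]] := countable_algebraic_closure F.
have [g gE] : exists g, val g = f.
  apply: (regular_is_polynomial ffL q_gt1 q_pchar j) => Q /negPf nQ.
  by have := fs Q; rewrite nQ oppr0.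
have gP i : evF (P i).1 (P i).2 g = emb (c i).
  by symmetry; apply/value_at_poly; rewrite gE.
have [h hq hE] := reduction ffL q_gt1 (g ^+ r - g).
have {}hE : val h = f ^+ r - f by rewrite hE raddfB /= rmorphXn /= gE.
have hP i : evF (P i).1 (P i).2 h = 0.
  rewrite (ev_curve_congr ffL (idfun : {rmorphism F -> F}) (h := g ^+ r - g) _ (point_curve i)); last first.
    by rewrite hE raddfB /= rmorphXn /= gE.
  by rewrite raddfB /= rmorphXn /= gP -rmorphXn /= -card_Fr expf_card subrr.
have h_weight i l : h`_l`_i != 0 -> (i * q + l * q.+1 <= s * r)%N.
  move=> hli; have h0 : h != 0 by apply: contraNneq hli => ->; rewrite !coef0.
  have [Q Qinf] := Pinf_exists ffL q_gt1 q_pchar.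
  have [Qx Qy] := Pinf_coords ffL q_gt1 Qinf.
  have Qh : ord_ge Q (- (s * r)%N%:Z) (val h).
    have := fs Q; rewrite Qinf hE => fQ; apply: ord_geD; last first.
      apply: ord_geN; case: fQ => [->|fQ]; [by left | right].
      by apply: le_trans fQ; rewrite lerN2 lez_nat leq_pmulr // r_gt0.
    case: fQ => [->|fQ]; first by left; rewrite expr0n eqn0Ngt r_gt0.
    have [->|f0] := eqVneq f 0; first by left; rewrite expr0n eqn0Ngt r_gt0.
    by right; rewrite ordX // PoszM -mulNr ler_wpM2r.
  rewrite -[q%:Z]mulr1 in Qx; rewrite -[q.+1%:Z]mulr1 in Qy.
  have [w Qw hw] := ord_reduced ffL q_gt1 ltr01 Qx Qy hq h0.
  case: Qh => [/eqP|]; first by rewrite (negPf (ev_reduced_neq0 ffL q_gt1 hq h0)).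
  by rewrite Qw mulr1 lerN2 lez_nat; apply: leq_trans (hw _ _ hli).
pose a : F := h`_(0%N)`_(q ^ 2)%N.
have q2_neq1 : (q ^ 2 != 1)%N by rewrite neq_ltn orbC -(exp1n 2) ltn_exp2r // q_gt1.
have hX : h = (a *: ('X^(q ^ 2) - 'X))%:P.
  apply/subr0_eq; apply: (reduced_vanishing q_gt1 card_F P_inj P_points).
  - rewrite (leq_trans (size_polyD _ _)) // geq_max hq size_polyN.
    by rewrite (leq_trans (size_polyC_leq1 _)) // q_gt0.
  - move=> l; apply/leq_sizeP => i qi; rewrite coefB coefC.
    have i1 : (i == 1)%N = false.
      by apply/negbTE; rewrite neq_ltn orbC (leq_trans _ qi) // -(exp1n 2) ltn_exp2r // q_gt1.
    have [hli|/h_weight hli] := eqVneq h`_l`_i 0.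
      case: eqP => [l0|_]; last by rewrite coefB hli coef0 subrr.
      have aE : a = h`_l`_(q ^ 2)%N by rewrite /a [l]l0.
      rewrite coefB coefZ coefB coefXn coefX i1 subr0 hli sub0r aE.
      by have [<-|_] := eqVneq i (q ^ 2)%N; rewrite ?hli ?mul0r ?mulr0 oppr0.
    have {}hli := leq_trans hli srq.
    have l0 : l = 0%N.
      case: l hli => // l; rewrite leqNgt => /negP[]; rewrite expnSr.
      by rewrite -[X in (X < _)%N]addn0 -addnS leq_add // leq_mul2r qi orbT.
    have iE : i = (q ^ 2)%N.
      apply/eqP; rewrite eqn_leq qi andbT -(leq_pmul2r q_gt0) -expnSr.
      exact: leq_trans (leq_addr _ _) hli.
    rewrite l0 iE eqxx coefB coefZ coefB coefXn coefX eqxx (negPf q2_neq1).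
    by rewrite subr0 mulr1 subrr.
  move=> i; rewrite raddfB /= hP ev_coef map_polyZ rmorphB /= map_polyXn map_polyX.
  by rewrite hornerZ hornerD hornerN hornerXn hornerX /= -card_F expf_card subrr mulr0 subrr.
have fE : f ^+ r - f = iota a * (x ^+ (q ^ 2) - x).
  rewrite -hE hX ev_coef map_polyZ rmorphB /= map_polyXn map_polyX.
  by rewrite hornerZ hornerD hornerN hornerXn hornerX.
have rL : [pchar L].-nat r by apply: pchar_nat_rmorph r_pchar.
pose t := power_trace r (2 * m) (iota a * x).
have [k kE] : exists k, f - t = iota (emb k).
  apply: (@frobenius_fixed _ _ (iota \o emb)); apply/subr0_eq; rewrite card_Fr.
  rewrite exprBn_pchar //.
  have -> : f ^+ r - t ^+ r - (f - t) = (f ^+ r - f) - (t ^+ r - t) by ring.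
  rewrite fE power_trace_frobenius // -qq_def exprMn -rmorphXn /= -card_F expf_card.
  by rewrite mulrBr subrr.
exists a, k; rewrite ev_trace_fun -kE -/t addrC subrK; split=> // srlt.
apply/eqP/idPn => /h_weight; rewrite mul0n addn0 -expnSr leqNgt.
by rewrite srlt.
Qed.

Lemma code_trace_fun s c : (s * r <= q ^ 3)%N ->
  subfield_subcode emb (hermitian_code iota x y P s) c ->
  exists a k, (forall i, emb (c ord0 i) = power_trace r (2 * m) (a * (P i).1) + emb k) /\
    ((s * r < q ^ 3)%N -> a = 0).
Proof.
move=> srq [f fs fP].
have {}fP i : value_at iota x y f (P i) (emb (c ord0 i)) by have := fP i; rewrite mxE.
have [a [k [fE a0]]] := trace_fun_of_code srq fs fP.
exists a, k; split=> // i; have := fP i; rewrite fE => /value_at_poly ->.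
by rewrite ev_trace_fun.
Qed.

Lemma trace_fun_code s a k (c : 'rV[Fr]_(q ^ 3)) : a = 0 \/ s = (q ^ 3 %/ r)%N ->
  (forall i, emb (c ord0 i) = power_trace r (2 * m) (a * (P i).1) + emb k) ->
  subfield_subcode emb (hermitian_code iota x y P s) c.
Proof.
move=> as_ cE; exists (val (trace_fun a k)); first exact: trace_fun_in_riemann_roch.
by move=> i; apply/value_at_poly; rewrite mxE cE ev_trace_fun.
Qed.

Lemma dim_below s : (s < q ^ 3 %/ r)%N ->
  linear_code_of_dim (subfield_subcode emb (hermitian_code iota x y P s)) 1.
Proof.
rewrite ltn_divRL ?r_dvd_q3 // => srlt.
pose ones : 'rV[Fr]_(q ^ 3) := const_mx 1.
exists <[ones]>%VS; last first.
  have q3 : (0 < q ^ 3)%N by rewrite expn_gt0 q_gt0.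
  have ones0 : ones != 0.
    apply/eqP => /rowP/(_ (Ordinal q3))/eqP; rewrite !mxE; exact/negP/oner_neq0.
  by rewrite dim_vline ones0.
move=> c; split=> [/vlineP[k ->]|/(code_trace_fun (ltnW srlt))[a [k [cE a0]]]].
  apply: (@trace_fun_code s 0 k); first by left.
  by move=> i; rewrite !mxE mulr1 mul0r power_trace0 ?r_gt0 // add0r.
apply/vlineP; exists k; apply/rowP => i; rewrite !mxE mulr1; apply: (fmorph_inj emb).
by rewrite cE a0 // mul0r power_trace0 ?r_gt0 // add0r.
Qed.

Lemma power_trace_in_subfield (z : F) : exists k, power_trace r (2 * m) z == emb k.
Proof.
have [|k ->] := @frobenius_fixed _ _ emb (power_trace r (2 * m) z); last by exists k.
apply/subr0_eq; rewrite card_Fr power_trace_frobenius ?r_pchar //.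
by rewrite -qq_def -card_F expf_card subrr.
Qed.

Definition subfield_trace (z : F) : Fr := xchoose (power_trace_in_subfield z).

Lemma subfield_traceP z : emb (subfield_trace z) = power_trace r (2 * m) z.
Proof. by symmetry; apply/eqP/(xchooseP (power_trace_in_subfield z)). Qed.

(** As a polynomial in [z] the trace has degree [r^(2 m - 1)], which is less
than the number of elements of [F]. *)
Lemma power_trace_nonzero : exists z : F, power_trace r (2 * m) z != 0.
Proof.
have [n nE] : exists n, (2 * m = n.+1)%N by exists (2 * m).-1; rewrite prednK // muln_gt0.
pose T : {poly F} := power_trace r n.+1 'X.
have T0 : T != 0.
  suff T1 : T`_1 = 1 by apply: contra_eq_neq T1 => ->; rewrite coef0 eq_sym oner_eq0.
  rewrite coef_sum big_ord_recl coefXn expn0 eqxx big1 ?addr0 // => i _.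
  rewrite coefXn; case: eqP => // /esym/eqP.
  by rewrite -[X in _ == X](expn0 r) eqn_exp2l // r_gt1.
have sT : (size T <= (r ^ n).+1)%N.
  rewrite (leq_trans (size_sum _ _ _)) //; apply/bigmax_leqP => i _.
  by rewrite size_polyXn ltnS leq_pexp2l ?r_gt0 // -ltnS.
have [roots|/allPn[z _ Tz]] := boolP (all (root T) (enum F)).
  have := max_poly_roots T0 roots (enum_uniq _).
  rewrite -cardE card_F qq_def nE ltnNge => /negP[].
  rewrite (leq_trans sT) // ltn_exp2l ?r_gt1 //.
exists z; rewrite nE; move: Tz; rewrite rootE -[_.[_]]/(horner_eval z _).
by rewrite rmorph_power_trace /= /horner_eval hornerX.
Qed.

Definition trace_word (u : F * Fr) : 'rV[Fr]_(q ^ 3) :=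
  \row_i (subfield_trace (u.1 * (P i).1) + u.2).

Lemma emb_trace_word u i :
  emb (trace_word u ord0 i) = power_trace r (2 * m) (u.1 * (P i).1) + emb u.2.
Proof. by rewrite mxE rmorphD subfield_traceP. Qed.

Lemma trace_word_linear k u v :
  k *: trace_word u + trace_word v = trace_word (emb k * u.1 + v.1, k * u.2 + v.2).
Proof.
apply/rowP => i; apply: (fmorph_inj emb); rewrite emb_trace_word !mxE.
rewrite !rmorphD !rmorphM !rmorphD !subfield_traceP /= mulrDl power_traceD ?r_pchar //.
rewrite -mulrA; have -> : power_trace r (2 * m) (emb k * (u.1 * (P i).1)) =
    emb k * power_trace r (2 * m) (u.1 * (P i).1).
  rewrite /power_trace mulr_sumr; apply: eq_bigr => l _.
  rewrite exprMn -rmorphXn /=; congr (emb _ * _).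
  elim: (l : nat) => [|n IH]; first by rewrite expn0 expr1.
  by rewrite expnSr exprM IH -card_Fr expf_card.
ring.
Qed.

Lemma trace_word_inj : injective trace_word.
Proof.
suff ker u : trace_word u = 0 -> u = (0, 0).
  move=> u v uv; have /ker[] : trace_word (emb (-1) * v.1 + u.1, -1 * v.2 + u.2) = 0.
    by rewrite -trace_word_linear uv scaleN1r addNr.
  rewrite rmorphN1 !mulN1r => /eqP; rewrite addrC subr_eq0 => /eqP E /eqP.
  by rewrite addrC subr_eq0 => /eqP E'; case: u v E E' {uv} => u1 u2 [v1 v2] /= -> ->.
move=> u0.
have T0 z : power_trace r (2 * m) (u.1 * z) + emb u.2 = 0.
  have [i <-] := fibre_point q_gt1 card_F P_inj P_points z.
  by rewrite -emb_trace_word u0 mxE rmorph0.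
have u20 : u.2 = 0.
  apply: (fmorph_inj emb); rewrite rmorph0.
  by have := T0 0; rewrite mulr0 power_trace0 ?r_gt0 // add0r.
suff u10 : u.1 = 0 by case: u u10 u20 {u0 T0} => u1 u2 /= -> ->.
apply/eqP/idPn => u10; have [z /eqP[]] := power_trace_nonzero.
by have := T0 (u.1^-1 * z); rewrite mulVKf // u20 rmorph0 addr0.
Qed.

Lemma dim_at : linear_code_of_dim
  (subfield_subcode emb (hermitian_code iota x y P (q ^ 3 %/ r))) (2 * m + 1).
Proof.
pose S := [set trace_word u | u : F * Fr].
have [|k u v /imsetP[u' _ ->] /imsetP[v' _ ->]|V VS cardV] := @vspace_of_closed_set _ _ S.
- apply/imsetP; exists (0, 0) => //; apply/rowP => i; apply: (fmorph_inj emb).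
  by rewrite emb_trace_word mxE !rmorph0 mul0r power_trace0 ?r_gt0 // addr0.
- by rewrite trace_word_linear imset_f.
have sr : (q ^ 3 %/ r * r)%N = (q ^ 3)%N by rewrite divnK // r_dvd_q3.
exists V; last first.
  apply/eqP; rewrite -(eqn_exp2l _ _ r_gt1) -{1}card_Fr -cardV.
  rewrite card_imset; last exact: trace_word_inj.
  by rewrite card_prod card_F card_Fr qq_def expnD expn1.
move=> c; rewrite VS; split=> [/imsetP[u _ ->]|].
  by apply: trace_fun_code (emb_trace_word u); right.
move=> /(code_trace_fun (eq_leq sr))[a [k [cE _]]]; apply/imsetP; exists (a, k) => //.
by apply/rowP => i; apply: (fmorph_inj emb); rewrite emb_trace_word cE.
Qed.

End SubfieldSubcode.

Theorem theorem5p1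
  (p e r m q : nat) (p_prime : prime p) (e_gt0 : (0 < e)%N)
  (r_def : r = (p ^ e)%N) (m_ge1 : (1 <= m)%N) (q_def : q = (r ^ m)%N)
  (Fr F : finFieldType) (card_Fr : #|Fr| = r) (card_F : #|F| = (q ^ 2)%N)
  (emb : {rmorphism Fr -> F})
  (L : fieldType) (iota : {rmorphism F -> L}) (x y : L)
  (function_field : hermitian_function_field iota x y q)
  (P : 'I_(q ^ 3) -> F * F) (P_inj : injective P)
  (P_points : forall ab : F * F, on_curve q ab <-> exists i, P i = ab)
  (s : nat) :
  ((s < q ^ 3 %/ r)%N ->
     linear_code_of_dim
       (subfield_subcode emb (hermitian_code iota x y P s)) 1) /\
  (s = (q ^ 3 %/ r)%N ->
     linear_code_of_dim
       (subfield_subcode emb (hermitian_code iota x y P s)) (2 * m + 1)).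
Proof.
split=> [s_lt|->].
  exact: (dim_below p_prime e_gt0 r_def m_ge1 q_def).
exact: (dim_at p_prime e_gt0 r_def m_ge1 q_def).
Qed.
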